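(* Let $p\in\mathbb N$ and let $c_1,\dots,c_p\in\mathbb R$ be pairwise distinct. Let $H_{\vec n}$ and $H^{(i)}_{\vec n}$ ($i=1,\dots,p$) be the multiple Hermite polynomials of type II (monic) and type I given in the context. Let $k\in\{1,\dots,p\}$, let $\pi$ be any permutation of $\{1,\dots,p\}$, and let $\vec s_j$, $S(\pi,j)$, $S^{\mathsf c}(\pi,j)$ be as in the context. Then the nearest-neighbor recurrence relations $$xH_{\vec n}(x)=H_{\vec n+\vec e_k}(x)+b^0_{\vec n}(k)H_{\vec n}(x)+\sum_{j=1}^p b^j_{\vec n}H_{\vec n-\vec s_j}(x),$$ $$xH^{(i)}_{\vec n}(x)=H^{(i)}_{\vec n-\vec e_k}(x)+b^0_{\vec n-\vec e_k}(k)H^{(i)}_{\vec n}(x)+\sum_{j=1}^p b^j_{\vec n+\vec s_{j-1}}H^{(i)}_{\vec n+\vec s_j}(x),\qquad i\in\{1,\dots,p\},$$ hold for all $\vec n\in\mathbb N_0^p$ such that all multi-indices occurring in the respective relation have non-negative entries, where $$b^0_{\vec n}(k)=\frac{c_k}{2},\qquad b^j_{\vec n}=\frac1{2^j}\sum_{i\in S(\pi,j)}n_i\prod_{q\in S^{\mathsf c}(\pi,j)}(c_i-c_q),\quad j\in\{1,\dots,p\}.$$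
   Context: $\mathbb N_0=\{0,1,2,\dots\}$; $|\vec n|=n_1+\cdots+n_p$; $(x)_0=1$, $(x)_n=x(x+1)\cdots(x+n-1)$; empty products equal $1$ and empty sums equal $0$; $0^0=1$; $\vec e_k$ is the $k$-th canonical basis vector of $\mathbb R^p$. For a permutation $\pi$ of $\{1,\dots,p\}$: $\vec s_0=\vec 0$, $\vec s_j=\sum_{i=1}^j\vec e_{\pi(i)}$, $S(\pi,j)=\{i\in\{1,\dots,p\}: j\le\pi^{-1}(i)\}$, $S^{\mathsf c}(\pi,j)=\{1,\dots,p\}\setminus S(\pi,j)$. The multiple Hermite polynomials are the multiple orthogonal polynomials for the weights $e^{-x^2+c_ix}$, $i=1,\dots,p$, with respect to $dx$ on $\mathbb R$. Let $H_n(x)=\sum_{k=0}^{\lfloor n/2\rfloor}(-1)^k\frac{(-n)_{2k}}{k!}\frac{x^{n-2k}}{2^{2k}}$, $n\in\mathbb N_0$, be the usual monic Hermite polynomials (scalar index). Type II (monic, degree $|\vec n|$): $$H_{\vec n}(x)=\left(-\frac12\right)^{|\vec n|}\sum_{l_1=0}^{n_1}\cdots\sum_{l_p=0}^{n_p}2^{l_1+\cdots+l_p}\prod_{q=1}^p\frac{(-n_q)_{l_q}}{l_q!}c_q^{\,n_q-l_q}\;H_{l_1+\cdots+l_p}(x).$$ Type I: $H^{(i)}_{\vec n}=0$ if $n_i=0$, and if $n_i\ge1$, $$H^{(i)}_{\vec n}(x)=\frac{(-1)^{n_i-1}}{\sqrt\pi\,(n_i-1)!}\,\frac{2^{|\vec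 n|-1}e^{-c_i^2/4}}{\prod_{q\ne i}(c_i-c_q)^{n_q}}\sum_{\substack{l_1,\dots,l_p\ge0\\ l_1+\cdots+l_p\le n_i-1}}\frac{(-n_i+1)_{l_1+\cdots+l_p}}{l_i!}\prod_{q\ne i}\frac{(n_q)_{l_q}}{l_q!\,(c_q-c_i)^{l_q}}\,H_{n_i-1-l_1-\cdots-l_p}\left(\frac{c_i}{2}\right)x^{l_i}.$$ *)

(* Defs.v *)
From HB Require Import structures.
From mathcomp Require Import all_boot all_order all_algebra all_fingroup.
From mathcomp Require Import reals sequences exp trigo.

Set Implicit Arguments.
Unset Strict Implicit.
Unset Printing Implicit Defensive.

Import Order.TTheory GRing.Theory Num.Theory.

Local Open Scope ring_scope.

(* Multi-indices in N_0^p; [0] and [n + m] are the pointwise operations of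
   the nmodType structure on {ffun 'I_p -> nat}.  The indices 1..p of the
   mathematics are the ordinals 0..p-1. *)
Notation mindex p := {ffun 'I_p -> nat}.

Definition mnorm (p : nat) (n : mindex p) : nat := (\sum_(q < p) n q)%N.

Definition mle (p : nat) (m n : mindex p) : Prop :=
  forall q : 'I_p, (m q <= n q)%N.

(* Truncated at 0, hence the intended difference only when [mle m n]. *)
Definition msub (p : nat) (n m : mindex p) : mindex p :=
  [ffun q : 'I_p => (n q - m q)%N].

Definition munit (p : nat) (k : 'I_p) : mindex p :=
  [ffun q : 'I_p => (q == k : nat)].

(* s_j = e_{pi(1)} + ... + e_{pi(j)}, for 0 <= j <= p. *)
Definition msteps (p : nat) (s : 'S_p) (j : nat) : mindex p :=
  \sum_(i < p | (i < j)%N) munit (s i).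

(* S(pi, j) for 1 <= j <= p; the successor accounts for the ordinals
   starting at 0.  Its complement is [~: Sset s j]. *)
Definition Sset (p : nat) (s : 'S_p) (j : nat) : {set 'I_p} :=
  [set i : 'I_p | (j <= ((s^-1)%g i).+1)%N].

Definition pochhammer (R : pzRingType) (x : R) (n : nat) : R :=
  \prod_(i < n) (x + i%:R).

Definition hermite (R : fieldType) (n : nat) : {poly R} :=
  \sum_(k < n./2.+1)
    ((-1) ^+ k * (pochhammer (- n%:R) (2 * k) / k`!%:R) / 2 ^+ (2 * k))
      *: 'X^(n - 2 * k).

(* The sum is over all l with l_q <= n_q for every q; the bound |n| on the
   entries only makes the index type finite. *)
Definition hermite_typeII (R : fieldType) (p : nat) (c : 'I_p -> R)
    (n : mindex p) : {poly R} :=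
  (- (1 / 2)) ^+ mnorm n *:
  \sum_(l : {ffun 'I_p -> 'I_(mnorm n).+1} | [forall q, (l q <= n q)%N])
    (2 ^+ (\sum_(q < p) l q)%N *
     \prod_(q < p) (pochhammer (- (n q)%:R) (l q) / (l q)`!%:R
                    * c q ^+ (n q - l q)))
      *: hermite R (\sum_(q < p) l q)%N.

(* The sum is over all l with l_1 + ... + l_p <= n_i - 1; such an l has all
   its entries below n_i. *)
Definition hermite_typeI (R : realType) (p : nat) (c : 'I_p -> R)
    (n : mindex p) (i : 'I_p) : {poly R} :=
  if n i == 0%N then 0 else
  ((-1) ^+ (n i - 1) / (Num.sqrt pi * (n i - 1)`!%:R)
   * (2 ^+ (mnorm n - 1) * expR (- (c i ^+ 2 / 4))
      / \prod_(q < p | q != i) (c i - c q) ^+ n q)) *: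
  \sum_(l : {ffun 'I_p -> 'I_(n i)} | (\sum_(q < p) l q <= n i - 1)%N)
    (pochhammer (- (n i)%:R + 1) (\sum_(q < p) l q)%N / (l i)`!%:R
     * \prod_(q < p | q != i) (pochhammer (n q)%:R (l q)
                               / ((l q)`!%:R * (c q - c i) ^+ l q))
     * (hermite R (n i - 1 - \sum_(q < p) l q)%N).[c i / 2])
      *: 'X^(l i).

(* b^0_n(k); it does not depend on n. *)
Definition nnr_b0 (R : fieldType) (p : nat) (c : 'I_p -> R) (n : mindex p)
    (k : 'I_p) : R := c k / 2.

(* b^j_n, for 1 <= j <= p. *)
Definition nnr_b (R : fieldType) (p : nat) (c : 'I_p -> R) (s : 'S_p)
    (j : nat) (n : mindex p) : R :=
  1 / 2 ^+ j *
  \sum_(i in Sset s j) (n i)%:R * \prod_(q in ~: Sset s j) (c i - c q).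

(* Main.v *)
From HB Require Import structures.
Require Import Defs.
From mathcomp Require Import all_boot all_order all_algebra all_fingroup.
From mathcomp Require Import reals sequences exp trigo.
From mathcomp Require Import ring zify.

(** Both families have a description in which multiplication by [x] becomes a
    differential operator acting on a product of powers of [t - c_q], and the
    two recurrences are then the same partial-fraction identity.

    Type II: let [L] be the linear map with [L ('X^m) = hermite m]
    ([hermite_transform]).  The multinomial formula in the definition says that
    [H_n = L (\prod_q ('X - c_q / 2) ^+ n_q)] ([hermite_typeII_transform]), and
    the three-term recurrence [hermite_rec] says that
    [x * L Q = L ('X * Q + Q' / 2)] ([mulX_hermite_transform]).  With [Q] the
    product of powers, ['X * Q] gives the terms in [n + e_k] and [n], while
    [Q'] is a combination of the [n - e_q].

    Type I: up to a constant, the value of [H_n^(i)] at [x] is [2 ^+ |n|] times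
    the residue at [t = c_i] of
    [e^(x (t - c_i) - t^2 / 4) / \prod_q (t - c_q) ^+ n_q]
    ([horner_hermite_typeI]).  A derivative has no residue, which gives
    [x Res_n = Res_n[t / 2] + \sum_q n_q Res_(n + e_q)] ([residue_by_parts]);
    writing [t / 2 = (t - c_k) / 2 + c_k / 2] gives the terms in [n - e_k]
    and [n].

    In both cases it remains to rewrite a combination over the [p] directions
    [e_q] as one over the staircase [s_1, ..., s_p] of the permutation.  After
    clearing denominators this is [newton_identity]: each
    [\prod_(q | q != i) ('X - a_q)] is expanded in the Newton basis
    [\prod_(u >= j) ('X - a_(s u))], its coefficients being the products of
    differences [a_i - a_q] that make up [b^j_n]. *)

Set Implicit Arguments.
Unset Strict Implicit.
Unset Printing Implicit Defensive.

Import Order.TTheory GRing.Theory Num.Theory.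

Local Open Scope ring_scope.

(** * Pochhammer symbols and derivatives of products *)

Section Pochhammer.
Variable R : comPzRingType.
Implicit Types (x : R) (n m : nat).

Lemma pochhammer0 x : pochhammer x 0 = 1.
Proof. by rewrite /pochhammer big_ord0. Qed.

Lemma pochhammerS x n : pochhammer x n.+1 = pochhammer x n * (x + n%:R).
Proof. by rewrite /pochhammer big_ord_recr. Qed.

Lemma pochhammerSl x n : pochhammer x n.+1 = x * pochhammer (x + 1) n.
Proof.
rewrite /pochhammer big_ord_recl addr0; congr (_ * _).
apply: eq_bigr => i _; rewrite /= /bump /= -addrA -natr1.
by rewrite [in RHS]addrC addrC natr1 nat1r.
Qed.

Lemma pochhammer_opp_nat n m :
  pochhammer (- n%:R : R) m = (-1) ^+ m * (n ^_ m)%:R.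
Proof.
elim: m => [|m IHm]; first by rewrite pochhammer0 mul1r.
rewrite pochhammerS IHm ffactnSr natrM exprS.
have [le_mn|lt_nm] := leqP m n; first by rewrite natrB //; ring.
by rewrite ffact_small // !(mulr0, mul0r).
Qed.
End Pochhammer.

Lemma deriv_prod (R : comNzRingType) (I : finType) (F : I -> {poly R}) :
  (\prod_i F i)^`() = \sum_i (F i)^`() * \prod_(j | j != i) F j.
Proof.
have: uniq (index_enum I) by exact: index_enum_uniq.
elim: (index_enum I) => [|a r IHr] /=; first by rewrite !big_nil derivC.
case/andP=> a_notin_r uniq_r; rewrite !big_cons derivM (IHr uniq_r) eqxx /=.
congr (_ * _ + _).
  rewrite [RHS]big_seq_cond [LHS]big_seq.
  by apply: eq_big => // j; case: eqP => [->|_]; rewrite ?(negPf a_notin_r) ?andbT.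
rewrite big_distrr /= !big_seq; apply: eq_bigr => i i_in_r.
rewrite big_cons ifT; last by apply: contraNneq a_notin_r => ->.
by rewrite mulrCA.
Qed.

(** * Newton interpolation *)

Section Newton.
Variables (R : fieldType) (p : nat) (s : 'S_p).
Implicit Types a : 'I_p -> R.

(** Up to the factor [1 / 2 ^+ j], the coefficient [b^j] for arbitrary nodes [a]
    and weights [w] in place of [c] and the multi-index. *)
Definition newton_coef a (w : 'I_p -> R) (j : nat) : R :=
  \sum_(i in Sset s j) w i * \prod_(q in ~: Sset s j) (a i - a q).

Lemma in_Sset (j : nat) (u : 'I_p) : (s u \in Sset s j) = (j <= u.+1)%N.
Proof. by rewrite inE permK. Qed.

(** Multiply by ['X - (b t)%:P]: moving the node [b j] from the second product
    to the first changes it by exactly ['X - b t] times the [j]-th summand, so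
    the right-hand side telescopes, and the last term contains [b t - b t]. *)
Lemma newton_basis (b : 'I_p -> R) (t : 'I_p) :
  \prod_(u | u != t) ('X - (b u)%:P) =
  \sum_(j < p) (\prod_(u : 'I_p | (u < j)%N) (b t - b u))
     *: \prod_(u : 'I_p | (j < u)%N) ('X - (b u)%:P).
Proof.
pose F j := - \prod_(u : 'I_p | (u < j)%N) (b t - b u)
     *: \prod_(u : 'I_p | (j <= u)%N) ('X - (b u)%:P).
apply: (@mulfI _ ('X - (b t)%:P)); first by rewrite polyXsubC_eq0.
transitivity (F p - F 0%N).
  have -> : F 0%N = - \prod_u ('X - (b u)%:P).
    by rewrite /F [X in - X *: _]big_pred0 // scaleN1r.
  rewrite /F [X in - X *: _](bigD1 t) //= subrr mul0r oppr0 scale0r sub0r opprK.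
  by rewrite [RHS](bigD1 t).
rewrite -(telescope_sumr F (leq0n p)) big_mkord mulr_sumr.
apply: eq_bigr => j _; rewrite /F.
have -> : \prod_(u : 'I_p | (u < j.+1)%N) (b t - b u) =
    (b t - b j) * \prod_(u : 'I_p | (u < j)%N) (b t - b u).
  rewrite (bigD1 j) ?ltnSn //=; congr (_ * _).
  by apply: eq_bigl => u; rewrite ltnS [RHS]ltn_neqAle andbC.
have -> : \prod_(u : 'I_p | (j <= u)%N) ('X - (b u)%:P) =
    ('X - (b j)%:P) * \prod_(u : 'I_p | (j < u)%N) ('X - (b u)%:P).
  rewrite (bigD1 j) //=; congr (_ * _).
  by apply: eq_bigl => u; rewrite [RHS]ltn_neqAle andbC eq_sym.
rewrite -!mul_polyC !rmorphN !rmorphM !rmorphB /=; ring.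
Qed.

Lemma newton_identity a (w : 'I_p -> R) :
  \sum_i w i *: \prod_(q | q != i) ('X - (a q)%:P) =
  \sum_(1 <= j < p.+1) newton_coef a w j
     *: \prod_(u : 'I_p | (j <= u)%N) ('X - (a (s u))%:P).
Proof.
have expand (t : 'I_p) : \prod_(q | q != s t) ('X - (a q)%:P) =
    \sum_(j < p) (\prod_(q in ~: Sset s j.+1) (a (s t) - a q))
      *: \prod_(u : 'I_p | (j < u)%N) ('X - (a (s u))%:P).
  rewrite (reindex_inj (@perm_inj _ s)) /=.
  rewrite (eq_bigl (fun u => u != t)); last by move=> u; rewrite (inj_eq perm_inj).
  rewrite (newton_basis (a \o s)); apply: eq_bigr => j _; congr (_ *: _).
  rewrite [RHS](reindex_inj (@perm_inj _ s)) /=; apply: eq_bigl => u.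
  by rewrite inE in_Sset -ltnNge ltnS.
rewrite (reindex_inj (@perm_inj _ s)) /=.
under eq_bigr do rewrite expand scaler_sumr.
rewrite exchange_big /= big_add1 big_mkord; apply: eq_bigr => j _.
under eq_bigr do rewrite scalerA.
rewrite -scaler_suml; congr (_ *: _).
rewrite /newton_coef [in RHS]big_mkcond [RHS](reindex_inj (@perm_inj _ s)) /=.
apply: eq_bigr => t _; rewrite in_Sset ltnS; case: leqP => // lt_tj.
(* The node [s t] is itself among those already used: its term vanishes. *)
have st_used : s t \in ~: Sset s j.+1 by rewrite in_setC in_Sset -ltnNge ltnS.
by rewrite (bigD1 (s t)) //= subrr mul0r mulr0.
Qed.
End Newton.

(** * The three-term recurrence of the Hermite polynomials *)

Section HermiteRecurrence.
Variable R : numFieldType.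

(** The falling factorial vanishes for [2 * k > n], which allows the sums below
    to run over any sufficiently large range of [k]. *)
Definition hermite_coef (n k : nat) : R :=
  (-1) ^+ k * (n ^_ (2 * k))%:R / k`!%:R / 2 ^+ (2 * k).

Lemma fact_neq0 n : n`!%:R != 0 :> R.
Proof. by rewrite pnatr_eq0 -lt0n fact_gt0. Qed.

Lemma hermiteE (n K : nat) : (n./2 < K)%N ->
  hermite R n = \sum_(k < K) hermite_coef n k *: 'X^(n - 2 * k).
Proof.
move=> ltK; rewrite /hermite.
rewrite (big_ord_widen K (fun k => ((-1) ^+ k *
   (pochhammer (- n%:R) (2 * k) / k`!%:R) / 2 ^+ (2 * k)) *: 'X^(n - 2 * k))) //.
rewrite big_mkcond; apply: eq_bigr => k _; case: ltnP => hk.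
  by rewrite /hermite_coef pochhammer_opp_nat exprM sqrrN expr1n expr1n mul1r !mulrA.
by rewrite /hermite_coef ffact_small ?mulr0 ?mul0r ?scale0r //; lia.
Qed.

Lemma ffactSD (n j : nat) : (n.+1 ^_ j.+1 = n ^_ j.+1 + j.+1 * n ^_ j)%N.
Proof.
rewrite ffactSS ffactnSr.
have [le_jn|lt_nj] := leqP j n; last by rewrite ffact_small // !muln0.
by rewrite [X in (X + _)%N]mulnC -mulnDl; congr (_ * _)%N; lia.
Qed.

Lemma hermite_coefS (n k : nat) :
  hermite_coef n k.+1 = hermite_coef n.+1 k.+1 + n%:R / 2 * hermite_coef n.-1 k.
Proof.
rewrite /hermite_coef.
have -> : (n.+1 ^_ (2 * k.+1) =
    n ^_ (2 * k.+1) + 2 * k.+1 * (n * n.-1 ^_ (2 * k)))%N.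
  by rewrite mulnS add2n ffactSD [n ^_ (2 * k).+1]ffactnS.
have f1 := fact_neq0 k; have f2 : k.+1%:R != 0 :> R by rewrite pnatr_eq0.
have f3 : (2 : R) ^+ (2 * k) != 0 by rewrite expf_neq0 // pnatr_eq0.
have -> : (2 : R) ^+ (2 * k.+1) = 4 * 2 ^+ (2 * k).
  by rewrite mulnS exprD -natrX.
move: (n ^_ _)%N (n.-1 ^_ _)%N (2 ^+ _ : R) f3 => u v w f3.
rewrite factS natrD !(natrM R) exprS; field.
by rewrite f1 f3 addrC natr1 f2.
Qed.

Lemma hermite_rec (n : nat) :
  'X * hermite R n = hermite R n.+1 + (n%:R / 2) *: hermite R n.-1.
Proof.
rewrite (@hermiteE n n.+2) ?(@hermiteE n.+1 n.+2) ?(@hermiteE n.-1 n.+1); try lia.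
rewrite !(big_ord_recl n.+1) mulrDr -addrA; congr (_ + _).
  by rewrite /hermite_coef !ffactn0 !muln0 !subn0 -scalerAr -exprS.
rewrite mulr_sumr scaler_sumr -big_split /=; apply: eq_bigr => k _.
rewrite /bump /= add1n -scalerAr -exprS scalerA.
have -> : (n.-1 - 2 * k = n.+1 - 2 * k.+1)%N by lia.
rewrite -scalerDl -hermite_coefS.
have [le_kn|lt_nk] := leqP (2 * k.+1) n; first by rewrite subSn.
by rewrite /hermite_coef ffact_small // mulr0 !mul0r !scale0r.
Qed.
End HermiteRecurrence.

(** * Type II polynomials as images of products of powers *)

Section TypeII.
Variable R : numFieldType.
Implicit Types Q : {poly R}.

Definition hermite_transform Q : {poly R} :=
  \sum_(m < size Q) Q`_m *: hermite R m.

Lemma hermite_transform_widen (M : nat) Q : (size Q <= M)%N ->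
  hermite_transform Q = \sum_(m < M) Q`_m *: hermite R m.
Proof.
move=> leM; rewrite /hermite_transform.
rewrite (big_ord_widen M (fun m => Q`_m *: hermite R m)) // big_mkcond.
by apply: eq_bigr => m _; case: ltnP => // ?; rewrite nth_default ?scale0r.
Qed.

Lemma hermite_transform_is_linear : linear hermite_transform.
Proof.
move=> a P Q; pose M := maxn (size P) (size Q).
rewrite !(@hermite_transform_widen M) ?leq_maxl ?leq_maxr //; last first.
  apply: leq_trans (size_polyD _ _) _; rewrite geq_max leq_maxr andbT.
  exact: leq_trans (size_scale_leq _ _) (leq_maxl _ _).
rewrite scaler_sumr -big_split; apply: eq_bigr => m _ /=.
by rewrite coefD coefZ scalerDl scalerA.
Qed.

HB.instance Definition _ :=
  GRing.isLinear.Build R {poly R} {poly R} _ hermite_transform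
    hermite_transform_is_linear.

Lemma hermite_transformXn m : hermite_transform 'X^m = hermite R m.
Proof.
rewrite /hermite_transform size_polyXn big_ord_recr /= coefXn eqxx scale1r.
rewrite big1 ?add0r // => i _.
by rewrite coefXn (ltn_eqF (ltn_ord i)) scale0r.
Qed.

(** By linearity this is the three-term recurrence on monomials, the lowering
    term [m / 2 * hermite m.-1] being half the derivative of ['X^m]. *)
Lemma mulX_hermite_transform Q :
  'X * hermite_transform Q =
  hermite_transform ('X * Q + (1 / 2) *: Q^`()).
Proof.
have defQ : Q = \sum_(m < size Q) Q`_m *: 'X^m by rewrite -poly_def coefK.
move: (size Q) defQ => M ->.
rewrite [_^`()](raddf_sum (@deriv R)) scaler_sumr linear_sum !mulr_sumr.
rewrite -big_split linear_sum /=.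
apply: eq_bigr => m _.
rewrite linearZ /= hermite_transformXn derivZ derivXn -!scalerAr hermite_rec.
rewrite !linearD !linearZ /= -exprS !linearMn /= !hermite_transformXn.
by rewrite -[in RHS]scaler_nat !scalerA; congr (_ + _ *: _); field.
Qed.

Variables (p : nat) (c : 'I_p -> R).
Implicit Types n : mindex p.

Definition typeII_symbol n : {poly R} := \prod_q ('X - (c q / 2)%:P) ^+ n q.

Lemma mnorm_ge n q : (n q <= mnorm n)%N.
Proof. by rewrite /mnorm (bigD1 q) //= leq_addr. Qed.

(** The sum in the definition is the expansion of the product by the binomial
    theorem in each factor: the powers of [-1/2], [2] and [-1] attached to [l q]
    cancel, leaving those of [- (c q / 2)]. *)
Lemma hermite_typeII_transform n :
  hermite_typeII c n = hermite_transform (typeII_symbol n).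
Proof.
have binomial q : ('X - (c q / 2)%:P) ^+ n q =
    (- (1 / 2)) ^+ n q *: \sum_(l < (mnorm n).+1 | (l <= n q)%N)
      (2 ^+ l * (pochhammer (- (n q)%:R) l / l`!%:R * c q ^+ (n q - l))) *: 'X^l.
  rewrite addrC exprDn.
  pose F l := (- (c q / 2)%:P) ^+ (n q - l) * 'X ^+ l *+ 'C(n q, l).
  rewrite (big_ord_widen_cond (mnorm n).+1 xpredT F) ?ltnS ?mnorm_ge // /F.
  rewrite scaler_sumr; apply: eq_big => [l|l]; first by rewrite ltnS.
  rewrite ltnS => le_ln; rewrite -polyCN -rmorphXn mul_polyC -scaler_nat !scalerA.
  congr (_ *: _).
  rewrite pochhammer_opp_nat -bin_ffact natrM.
  rewrite -[(-1) ^+ l * _ / _]mulrA mulfK ?fact_neq0 //.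
  have cancel_l : (- (1 / 2)) ^+ l * 2 ^+ l * (-1) ^+ l = 1 :> R.
    rewrite -!exprMn_comm; try exact: mulrC.
    by rewrite (_ : _ * -1 = 1) ?expr1n //; field.
  have -> : (- (1 / 2) : R) ^+ n q = (- (1 / 2)) ^+ (n q - l) * (- (1 / 2)) ^+ l.
    by rewrite -exprD subnK.
  rewrite (_ : - (c q / 2) = - (1 / 2) * c q); last by field.
  rewrite exprMn -[LHS]mulr1 -[X in _ * X = _]cancel_l.
  move: ((- (1 / 2)) ^+ (n q - l) : R) ((- (1 / 2)) ^+ l : R).
  by move: (2 ^+ l : R) ((-1) ^+ l : R) (c q ^+ _) => *; ring.
rewrite /typeII_symbol; under eq_bigr do rewrite binomial.
rewrite scaler_prod prodrXr bigA_distr_big_dep /hermite_typeII linearZ /=.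
congr (_ *: _); rewrite linear_sum /=; apply: eq_big => [l|l _].
  by apply/forallP/familyP => h q; have := h q.
rewrite scaler_prod prodrXr linearZ /=.
by rewrite hermite_transformXn [in RHS]big_split prodrXr.
Qed.
End TypeII.

(** * Multi-indices and recurrence coefficients *)

Lemma mindexDE (p : nat) (n m : mindex p) q : (n + m) q = (n q + m q)%N.
Proof. by rewrite ffunE. Qed.

Lemma munitE (p : nat) (k q : 'I_p) : munit k q = (q == k).
Proof. by rewrite ffunE. Qed.

Lemma mstepsE (p : nat) (s : 'S_p) (j : nat) (u : 'I_p) :
  msteps s j (s u) = (u < j)%N.
Proof.
rewrite /msteps sum_ffunE big_mkcond (bigD1 u) //= big1 ?addr0.
  by case: ltnP => _; rewrite // ffunE eqxx.
by move=> v neq_vu; rewrite ffunE (inj_eq perm_inj) eq_sym (negPf neq_vu) if_same.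
Qed.

Lemma nnr_b_newton (R : fieldType) (p : nat) (c : 'I_p -> R) (s : 'S_p) (j : nat)
    (n : mindex p) :
  nnr_b c s j n = 1 / 2 ^+ j * newton_coef s c (fun q => (n q)%:R) j.
Proof. by []. Qed.

(** Passing from the nodes [c] to the zeros [c / 2] of the symbol scales each of
    the [j - 1] differences by 1/2, which leaves one factor 1/2 of
    [1 / 2 ^+ j]. *)
Lemma nnr_b_half (R : numFieldType) (p : nat) (c : 'I_p -> R) (s : 'S_p) (j : nat)
    (n : mindex p) : (0 < j <= p)%N ->
  nnr_b c s j n = 1 / 2 * newton_coef s (fun q => c q / 2) (fun q => (n q)%:R) j.
Proof.
case/andP=> j_gt0 le_jp; rewrite nnr_b_newton /newton_coef !mulr_sumr.
apply: eq_bigr => i _.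
have -> : \prod_(q in ~: Sset s j) (c i / 2 - c q / 2) =
    (1 / 2) ^+ j.-1 * \prod_(q in ~: Sset s j) (c i - c q).
  have card_used : #|~: Sset s j| = j.-1.
    rewrite -(card_preimset _ (@perm_inj _ s)) -sum1_card.
    rewrite (eq_bigl (fun u : 'I_p => (u < j.-1)%N)); last first.
      by move=> u; rewrite !inE permK -ltnNge; lia.
    rewrite -(big_ord_widen p (fun=> 1%N)) ?sum1_card ?card_ord //.
    by rewrite (leq_trans (leq_pred _)).
  rewrite -card_used -prodr_const -big_split; apply: eq_bigr => q _ /=; by field.
have -> : (2 : R) ^+ j = 2 * 2 ^+ j.-1 by rewrite -exprS prednK.
rewrite expr_div_n expr1n.
have : (2 : R) ^+ j.-1 != 0 by rewrite expf_neq0 // pnatr_eq0.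
move: (2 ^+ _ : R) (\prod_(_ in _) _) => u v u_neq0; field; exact: u_neq0.
Qed.

(** * The type II recurrence *)

Section TypeIIRecurrence.
Variables (R : numFieldType) (p : nat) (c : 'I_p -> R) (s : 'S_p).
Implicit Types n : mindex p.

Lemma typeII_symbolD_unit n k :
  typeII_symbol c (n + munit k) = ('X - (c k / 2)%:P) * typeII_symbol c n.
Proof.
rewrite /typeII_symbol (bigD1 k) // [in RHS](bigD1 k) //= mulrA; congr (_ * _).
  by rewrite mindexDE ffunE eqxx addn1 exprS.
apply: eq_bigr => q neq_qk; by rewrite mindexDE ffunE (negPf neq_qk) addn0.
Qed.

(** All [n - s_j] lie above [n - s_p], so their symbols have a common factor,
    and the cofactors form the Newton basis. *)
Lemma typeII_symbol_sub_steps n j : (forall q, 0 < n q)%N ->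
  typeII_symbol c (msub n (msteps s j)) =
  typeII_symbol c (msub n (msteps s p))
    * \prod_(u : 'I_p | (j <= u)%N) ('X - (c (s u) / 2)%:P).
Proof.
move=> n_gt0; rewrite /typeII_symbol [LHS](reindex_inj (@perm_inj _ s)).
rewrite [X in _ = X * _](reindex_inj (@perm_inj _ s)) /=.
rewrite [X in _ * X]big_mkcond -big_split; apply: eq_bigr => u _ /=.
rewrite !ffunE !mstepsE ltn_ord; have n_u_gt0 := n_gt0 (s u).
by case: (leqP j u) => _; rewrite ?mulr1 // -exprSr subn1 subn0 prednK //.
Qed.

Lemma deriv_typeII_symbol n : (forall q, 0 < n q)%N ->
  (typeII_symbol c n)^`() =
  typeII_symbol c (msub n (msteps s p))
    * \sum_i (n i)%:R *: \prod_(q | q != i) ('X - (c q / 2)%:P).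
Proof.
move=> n_gt0; rewrite /typeII_symbol deriv_prod mulr_sumr; apply: eq_bigr => i _.
have step_p q : msteps s p q = 1%N by rewrite -[q](permKV s) mstepsE ltn_ord.
rewrite deriv_exp derivXsubC mul1r [X in _ = X * _](bigD1 i) //= ffunE step_p subn1.
rewrite -scaler_nat -scalerAl -scalerAr; congr (_ *: _).
rewrite -mulrA -big_split; congr (_ * _); apply: eq_bigr => q _ /=.
by rewrite ffunE step_p -exprSr subn1 prednK.
Qed.

Theorem typeII_recurrence n k :
  (forall j : nat, (1 <= j <= p)%N -> mle (msteps s j) n) ->
  'X * hermite_typeII c n =
    hermite_typeII c (n + munit k)
    + nnr_b0 c n k *: hermite_typeII c n
    + \sum_(1 <= j < p.+1)
        nnr_b c s j n *: hermite_typeII c (msub n (msteps s j)).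
Proof.
move=> steps_le_n.
have p_gt0 : (0 < p)%N by case: (p) k => [[]|].
have n_gt0 q : (0 < n q)%N.
  by have := steps_le_n p; rewrite p_gt0 leqnn => /(_ isT q);
     rewrite -[q](permKV s) mstepsE ltn_ord.
rewrite !hermite_typeII_transform mulX_hermite_transform typeII_symbolD_unit.
rewrite deriv_typeII_symbol // (newton_identity s).
rewrite [X in hermite_transform X]addrC linearD [RHS]addrC; congr (_ + _).
  rewrite mulr_sumr scaler_sumr linear_sum; apply: eq_big_nat => j j_in /=.
  rewrite nnr_b_half // hermite_typeII_transform [in RHS]typeII_symbol_sub_steps //.
  by rewrite -linearZ -scalerAr scalerA.
by rewrite -!linearZ -!linearD /= mulrBl mul_polyC subrK.
Qed.
End TypeIIRecurrence.

(** * Power series modulo a power of the variable *)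

Section TruncatedEquality.
Variable R : comNzRingType.
Implicit Types P Q : {poly R}.

(** Congruence modulo ['X^M], so that polynomials can stand for power series. *)
Definition eq_upto (M : nat) P Q := forall k, (k < M)%N -> P`_k = Q`_k.

Lemma eq_uptoD M P P' Q Q' :
  eq_upto M P P' -> eq_upto M Q Q' -> eq_upto M (P + Q) (P' + Q').
Proof. by move=> eqP eqQ k lt_kM; rewrite !coefD eqP ?eqQ. Qed.

Lemma eq_uptoM M P P' Q Q' :
  eq_upto M P P' -> eq_upto M Q Q' -> eq_upto M (P * Q) (P' * Q').
Proof.
move=> eqP eqQ k lt_kM; rewrite !coefM; apply: eq_bigr => j _.
have le_jk : (j <= k)%N by rewrite -ltnS.
rewrite eqP ?eqQ //; first exact: leq_ltn_trans (leq_subr _ _) lt_kM.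
exact: leq_ltn_trans le_jk lt_kM.
Qed.

Lemma eq_upto_sum M (I : finType) (A : pred I) (F G : I -> {poly R}) :
  (forall i, A i -> eq_upto M (F i) (G i)) ->
  eq_upto M (\sum_(i | A i) F i) (\sum_(i | A i) G i).
Proof.
by move=> eqFG; elim/big_ind2: _ => // P P' Q Q'; exact: eq_uptoD.
Qed.

Lemma eq_upto_prod M (I : finType) (A : pred I) (F G : I -> {poly R}) :
  (forall i, A i -> eq_upto M (F i) (G i)) ->
  eq_upto M (\prod_(i | A i) F i) (\prod_(i | A i) G i).
Proof.
by move=> eqFG; elim/big_ind2: _ => // P P' Q Q'; exact: eq_uptoM.
Qed.

Lemma eq_upto_coefXM M P Q k :
  eq_upto M P Q -> (k <= M)%N -> ('X * P)`_k = ('X * Q)`_k.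
Proof. by move=> eqPQ le_kM; rewrite !coefXM; case: k le_kM => //= k /eqPQ. Qed.

End TruncatedEquality.

(** * The series entering the residue *)

Section Series.
Variable R : numFieldType.
Implicit Types (a d x : R) (M n l m : nat).

(** Taylor expansion of [(d + w) ^ (- n)] at [w = 0]. *)
Definition pole_series d n M : {poly R} :=
  \poly_(l < M) ((-1) ^+ l * pochhammer n%:R l / l`!%:R / d ^+ (n + l)).

Definition exp_series x M : {poly R} := \poly_(l < M) (x ^+ l / l`!%:R).

(** Taylor expansion of [e^((a^2 - (a + w)^2) / 4)] at [w = 0], by the generating
    function of the Hermite polynomials. *)
Definition gauss_series a M : {poly R} :=
  \poly_(m < M) ((-1) ^+ m * (hermite R m).[a / 2] / m`!%:R).

Lemma succ_neq0 l : 1 + l%:R != 0 :> R.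
Proof. by rewrite nat1r pnatr_eq0. Qed.

Lemma mul_pole_series d n M : d != 0 ->
  eq_upto M (('X + d%:P) * pole_series d n.+1 M) (pole_series d n M).
Proof.
move=> d_neq0 k lt_kM; rewrite mulrDl coefD coefXM coefCM !coef_poly lt_kM.
case: k lt_kM => [|k] lt_kM /=.
  rewrite !pochhammer0 !addn0 add0r exprS.
  have := expf_neq0 n d_neq0; move: (d ^+ n) => e e_neq0; field.
  by rewrite d_neq0 e_neq0 fact_neq0.
rewrite (ltnW lt_kM) pochhammerS pochhammerSl.
rewrite !addSn !addnS !exprS factS natrM natr1.
have := expf_neq0 (n + k) d_neq0; move: (d ^+ (n + k)) => e e_neq0.
move: (pochhammer _ _) (fact_neq0 R k) => u f_neq0.
rewrite -!nat1r; field.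
by rewrite f_neq0 e_neq0 d_neq0 succ_neq0.
Qed.

Lemma deriv_pole_series d n M :
  eq_upto M.-1 (pole_series d n M)^`() (- n%:R *: pole_series d n.+1 M).
Proof.
move=> k lt_kM; rewrite coef_deriv coefZ !coef_poly !ifT; try lia.
rewrite pochhammerSl addSn addnS factS natrM !exprS natr1.
rewrite -[X in X = _]mulr_natr.
move: ((d * _)^-1) (pochhammer _ _) => e u; rewrite -!nat1r; field.
by rewrite fact_neq0 succ_neq0.
Qed.

Lemma deriv_exp_series x M :
  eq_upto M.-1 (exp_series x M)^`() (x *: exp_series x M).
Proof.
move=> k lt_kM; rewrite coef_deriv coefZ !coef_poly !ifT; try lia.
rewrite factS natrM exprS -[X in X = _]mulr_natr -nat1r; field.
by rewrite fact_neq0 succ_neq0.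
Qed.

(** The differential equation [G' = - (a + w) / 2 * G] of the Gaussian is, on
    coefficients, the three-term recurrence at [a / 2]. *)
Lemma deriv_gauss_series a M :
  eq_upto M.-1 (gauss_series a M)^`()
    (- (1 / 2) *: ((a%:P + 'X) * gauss_series a M)).
Proof.
move=> k lt_kM; rewrite coef_deriv coefZ mulrDl coefD coefCM coefXM !coef_poly.
have lt_k1M : (k.+1 < M)%N by lia.
rewrite lt_k1M (ltnW lt_k1M).
have := congr1 (horner^~ (a / 2)) (hermite_rec R k).
rewrite hornerM hornerX hornerD hornerZ => /eqP; rewrite -subr_eq => /eqP <-.
rewrite -mulr_natr; case: k lt_kM lt_k1M => [|k] lt_kM lt_k1M /=.
  by rewrite factS fact0; field.
rewrite (ltnW (ltnW lt_k1M)) !exprS !factS !natrM -!nat1r; field.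
by rewrite fact_neq0 succ_neq0 nat1r nat1r pnatr_eq0.
Qed.
End Series.

(** * Residues and integration by parts *)

Section Residue.
Variables (R : numFieldType) (p : nat) (c : 'I_p -> R) (i : 'I_p) (x : R).
Hypothesis c_inj : injective c.
Implicit Types (n m : mindex p) (M : nat) (phi : {poly R}).

(** In the variable [w = t - c_i], the factor of index [q] of the integrand is
    [(t - c_q) ^ (- n_q)]; at [q = i] the pole [w ^ (- n_i)] is left out, and
    the place is taken by [e^(x w)]. *)
Definition local_series (q : 'I_p) (l M : nat) : {poly R} :=
  if q == i then exp_series x M else pole_series (c i - c q) l M.

Definition integrand n M : {poly R} :=
  gauss_series (c i) M * \prod_q local_series q (n q) M.

(** The residue at [w = 0] of [phi * integrand / w ^+ (n i)], that is, the
    coefficient of order [n i - 1].  The extra factor ['X] makes it vanish when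
    [n i = 0], as a residue at a regular point should. *)
Definition residue M n phi : R := ('X * (phi * integrand n M))`_(n i).

Lemma residueD M n phi psi :
  residue M n (phi + psi) = residue M n phi + residue M n psi.
Proof. by rewrite /residue mulrDl mulrDr coefD. Qed.

Lemma residueZ M n a phi : residue M n (a *: phi) = a * residue M n phi.
Proof. by rewrite /residue -scalerAl -scalerAr coefZ. Qed.

Definition cofactor q n M : {poly R} :=
  gauss_series (c i) M * \prod_(j | j != q) local_series j (n j) M.

Lemma integrandE q n M :
  integrand n M = local_series q (n q) M * cofactor q n M.
Proof. by rewrite /integrand (bigD1 q) //= mulrCA. Qed.

Lemma cofactor_add_unit q n M : cofactor q (n + munit q) M = cofactor q n M.
Proof.
congr (_ * _); apply: eq_bigr => j neq_jq.
by rewrite mindexDE ffunE (negPf neq_jq) addn0.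
Qed.

Lemma integrand_add_unit_self n M : integrand (n + munit i) M = integrand n M.
Proof. by rewrite !(integrandE i) cofactor_add_unit /local_series eqxx. Qed.

Lemma mul_integrand_add_unit n M q : q != i ->
  eq_upto M (('X - (c q - c i)%:P) * integrand (n + munit q) M) (integrand n M).
Proof.
move=> neq_qi; rewrite !(integrandE q) cofactor_add_unit mulrA.
apply: eq_uptoM => //; rewrite /local_series (negPf neq_qi) mindexDE munitE eqxx.
rewrite addn1 -polyCN opprB; apply: mul_pole_series.
by rewrite subr_eq0 (inj_eq c_inj) eq_sym.
Qed.

(** The factor [t - c_q] lowers the order of the pole at [c_q] by one.  For
    [q = i] the factor is [w] itself, and the shift of the coefficient that is
    read off compensates it. *)
Lemma residue_pole_step M n q phi : (n i <= M)%N ->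
  residue M (n + munit q) (('X - (c q - c i)%:P) * phi) = residue M n phi.
Proof.
move=> le_niM; rewrite /residue mindexDE munitE.
have [<-|neq_qi] := eqVneq i q.
  by rewrite integrand_add_unit_self subrr subr0 addn1 -mulrA coefXM.
rewrite addn0; apply: eq_upto_coefXM le_niM.
rewrite mulrAC mulrC; apply: eq_uptoM => //.
by apply: mul_integrand_add_unit; rewrite eq_sym.
Qed.

Lemma residue_pole_steps M n (A : pred 'I_p) phi : (n i < M)%N ->
  residue M (n + \sum_(q | A q) munit q)
    (\prod_(q | A q) ('X - (c q - c i)%:P) * phi) = residue M n phi.
Proof.
move=> lt_niM.
have: ((\sum_(q | A q) munit q : mindex p)%R i <= 1)%N.
  rewrite sum_ffunE big_mkcond (bigD1 i) //= big1 ?addr0 ?munitE ?eqxx.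
    by case: ifP.
  by move=> q neq_qi; rewrite munitE eq_sym (negPf neq_qi) if_same.
elim/big_rec2: _ phi => [|q m P _ IHq] phi.
  by rewrite addr0 mul1r.
rewrite mindexDE => le_mi1.
rewrite [munit q + m]addrC addrA -mulrA residue_pole_step; first by apply: IHq; lia.
by rewrite mindexDE; lia.
Qed.

(** The logarithmic derivative of the exponential part is [x - t / 2], that of
    [(t - c_q) ^ (- n_q)] is [- n_q / (t - c_q)].  The pole at [c_i] is not part
    of [integrand] and reappears in [residue_by_parts]. *)
Lemma deriv_integrand n M :
  eq_upto M.-1 (integrand n M)^`()
    ((x%:P - (1 / 2) *: ((c i)%:P + 'X)) * integrand n M
     + \sum_(q | q != i) - (n q)%:R *: integrand (n + munit q) M).
Proof.
have rhsE : (x%:P - (1 / 2) *: ((c i)%:P + 'X)) * integrand n M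
     + \sum_(q | q != i) - (n q)%:R *: integrand (n + munit q) M =
  (- (1 / 2) *: (((c i)%:P + 'X) * gauss_series (c i) M))
    * \prod_q local_series q (n q) M
  + gauss_series (c i) M * \sum_q
     (if q == i then x *: local_series q (n q) M
      else - (n q)%:R *: local_series q (n q).+1 M)
      * \prod_(j | j != q) local_series j (n j) M.
  rewrite [X in _ = _ + _ * X](bigD1 i) //= eqxx mulrDr mulr_sumr.
  rewrite addrA; congr (_ + _).
    by rewrite /integrand (bigD1 i) //= -!mul_polyC rmorphN /=; ring.
  apply: eq_bigr => q neq_qi; rewrite (negPf neq_qi) (integrandE q).
  rewrite cofactor_add_unit mindexDE munitE eqxx addn1 /cofactor.
  by rewrite -scalerAl -scalerAr mulrCA.
rewrite rhsE /integrand derivM deriv_prod; apply: eq_uptoD; apply: eq_uptoM => //.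
  exact: deriv_gauss_series.
apply: eq_upto_sum => q _; apply: eq_uptoM => //; rewrite /local_series.
by case: eqP => _; [exact: deriv_exp_series | exact: deriv_pole_series].
Qed.

(** The residue of a derivative is zero.  In terms of coefficients, [n i] times
    the coefficient of order [n i] of [integrand], which is the term [q = i] of
    the sum, is the coefficient of order [n i - 1] of its derivative. *)
Lemma residue_by_parts M n : (n i < M)%N ->
  x * residue M n 1 =
  residue M n ((1 / 2) *: ((c i)%:P + 'X))
  + \sum_q (n q)%:R * residue M (n + munit q) 1.
Proof.
move=> lt_niM; rewrite (bigD1 i) //= /residue.
under eq_bigr => q neq_qi.
  rewrite mindexDE munitE eq_sym (negPf neq_qi) addn0 -coefZ; over.
rewrite integrand_add_unit_self mindexDE munitE eqxx addn1.
case def_ni: (n i) lt_niM => [|N] lt_NM.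
  rewrite !coefXM /= mulr0 mul0r !add0r big1 // => q _.
  by rewrite coefZ coefXM mulr0.
have := @deriv_integrand n M N; rewrite -ltnS (ltn_predK lt_NM) => /(_ lt_NM).
rewrite coef_deriv coefD mulrBl coefB mul_polyC coefZ coef_sum.
rewrite !mul1r !coefXM /= [N.+1%:R * _]mulr_natl => ->.
rewrite -[_ - _ + _ + _]addrA -big_split big1 => [|q _] /=.
  by rewrite addr0 addrC subrK.
by rewrite !coefZ coefXM mul1r /= mulNr addNr.
Qed.
End Residue.

Lemma poly_ext_horner (R : numFieldType) (P Q : {poly R}) :
  (forall x, P.[x] = Q.[x]) -> P = Q.
Proof.
move=> eqPQ; apply/eqP; rewrite -subr_eq0; apply/eqP.
apply: (@roots_geq_poly_eq0 _ _ [seq k%:R | k <- iota 0 (size (P - Q))]).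
- by apply/allP => y _; rewrite rootE hornerD hornerN eqPQ subrr.
- by rewrite map_inj_uniq ?iota_uniq // => k l /eqP; rewrite eqr_nat => /eqP.
- by rewrite size_map size_iota.
Qed.

(** * Type I polynomials as residues *)

Section TypeI.
Variables (R : realType) (p : nat) (c : 'I_p -> R) (i : 'I_p).
Hypothesis c_inj : injective c.
Implicit Types (n m : mindex p) (M : nat).

Definition typeI_const : R := expR (- (c i ^+ 2 / 4)) / (2 * Num.sqrt pi).

(** Expanding all factors but the Gaussian turns the coefficient into a sum over
    the exponents [l q] taken from them; the remaining order
    [N - \sum_q l q] falls to the Gaussian and selects the Hermite polynomial. *)
Lemma coef_integrand (x : R) n N :
  (integrand c i x n N.+1)`_N =
  \sum_(l : {ffun 'I_p -> 'I_N.+1} | (\sum_q l q <= N)%N)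
    (\prod_q (local_series c i x q (n q) N.+1)`_(l q))
    * ((-1) ^+ (N - \sum_q l q)%N * (hermite R (N - \sum_q l q)).[c i / 2]
       / (N - \sum_q l q)`!%:R).
Proof.
have expand q : local_series c i x q (n q) N.+1 =
    \sum_(l < N.+1) (local_series c i x q (n q) N.+1)`_l *: 'X^l.
  rewrite -poly_def; apply/polyP => k; rewrite coef_poly.
  case: ltnP => // le_Nk.
  by rewrite /local_series; case: eqP => _; rewrite coef_poly ltnNge le_Nk.
rewrite /integrand; under eq_bigr do rewrite expand.
rewrite bigA_distr_bigA mulr_sumr coef_sum [RHS]big_mkcond /=.
apply: eq_bigr => l _; rewrite scaler_prod prodrXr -scalerAr coefZ coefMXn.
case: ltnP => [_|le_lN]; first by rewrite mulr0.
by rewrite coef_poly ltnS leq_subr.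
Qed.

Lemma integrand_trunc (x : R) n N M : (N < M)%N ->
  (integrand c i x n M)`_N = (integrand c i x n N.+1)`_N.
Proof.
move=> lt_NM.
have trunc (E : nat -> R) : eq_upto N.+1 (\poly_(l < M) E l) (\poly_(l < N.+1) E l).
  by move=> k lt_kN; rewrite !coef_poly lt_kN (leq_trans lt_kN).
apply: (_ : eq_upto N.+1 _ _) (ltnSn N); apply: eq_uptoM; first exact: trunc.
by apply: eq_upto_prod => q _; rewrite /local_series; case: eqP => _; exact: trunc.
Qed.

(** With [2 ^+ mnorm n] and the halved constant instead of [2 ^+ (mnorm n - 1)],
    the formula also holds for [n = 0], where both sides vanish. *)
Lemma horner_hermite_typeI (x : R) n M : (n i <= M)%N ->
  (hermite_typeI c n i).[x] =
  typeI_const * 2 ^+ mnorm n * residue c i x M n 1.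
Proof.
move=> le_niM; rewrite /hermite_typeI /residue mul1r coefXM.
case def_ni: (n i) le_niM => [|N] le_NM /=; first by rewrite horner0 mulr0.
rewrite integrand_trunc // coef_integrand hornerZ horner_sum !mulr_sumr subn1 /=.
have norm_gt0 : (0 < mnorm n)%N by rewrite (leq_trans _ (mnorm_ge n i)) ?def_ni.
apply: eq_bigr => l le_lN; rewrite hornerZ hornerXn.
rewrite [in RHS](bigD1 i) //= {1}/local_series eqxx coef_poly ltn_ord.
have -> : \prod_(q | q != i) (local_series c i x q (n q) N.+1)`_(l q) =
    (\prod_(q | q != i) (pochhammer (n q)%:R (l q)
                               / ((l q)`!%:R * (c q - c i) ^+ l q)))
    / \prod_(q | q != i) (c i - c q) ^+ n q.
  rewrite -prodf_div; apply: eq_bigr => q neq_qi.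
  rewrite /local_series (negPf neq_qi) coef_poly ltn_ord.
  have cq_neq : c i - c q != 0 by rewrite subr_eq0 (inj_eq c_inj) eq_sym.
  have -> : (c q - c i) ^+ l q = (-1) ^+ l q * (c i - c q) ^+ l q.
    by rewrite -exprMn mulN1r opprB.
  rewrite exprD !invfM.
  have -> : ((-1) ^+ l q)^-1 = (-1) ^+ l q :> R by rewrite -exprVn invrN1.
  move: ((-1) ^+ l q : R) ((c i - c q) ^- n q) ((c i - c q) ^- l q) => *; ring.
have -> : - N.+1%:R + 1 = - N%:R :> R by rewrite -natr1; ring.
rewrite pochhammer_opp_nat.
have -> : (N ^_ (\sum_q l q))%:R = N`!%:R / (N - \sum_q l q)`!%:R :> R.
  by rewrite -(ffact_fact le_lN) natrM mulfK ?fact_neq0.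
have -> : (-1 : R) ^+ N = (-1) ^+ (N - \sum_q l q) * (-1) ^+ (\sum_q l q).
  by rewrite -exprD subnK.
have -> : (2 : R) ^+ mnorm n = 2 * 2 ^+ (mnorm n).-1 by rewrite -exprS prednK.
rewrite subn1 /typeI_const.
have sqrt_neq0 : Num.sqrt pi != 0 :> R by rewrite gt_eqF // sqrtr_gt0 pi_gt0.
(* The sign [(-1) ^+ L] occurs twice on the left and not at all on the right. *)
have sign_sq := sqrr_sign R (\sum_q l q); rewrite expr2 in sign_sq.
rewrite -[RHS]mulr1 -[X in _ = _ * X]sign_sq invfM.
have N_neq0 := fact_neq0 R N; have l_neq0 := fact_neq0 R (l i).
move: (\sum_q l q)%N => L; have NL_neq0 := fact_neq0 R (N - L).
move: (_ ^+ L) (_ ^+ (N - L)) (\prod_(_ | _) _)^-1 (\prod_(_ | _) _).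
move: (_ ^+ (mnorm n).-1) (expR _) (_.[_]) (_ ^+ l i) => *.
field.
by rewrite N_neq0 l_neq0 NL_neq0 sqrt_neq0.
Qed.
End TypeI.

(** * Norms and complements of multi-indices *)

Section Norm.
Variables (p : nat) (s : 'S_p).
Implicit Types (n m : mindex p).

Lemma mnormD n m : mnorm (n + m) = (mnorm n + mnorm m)%N.
Proof. by rewrite /mnorm -big_split; apply: eq_bigr => q _; rewrite mindexDE. Qed.

Lemma mnorm_unit (k : 'I_p) : mnorm (munit k) = 1%N.
Proof.
rewrite /mnorm (bigD1 k) //= munitE eqxx big1 // => q neq_qk.
by rewrite munitE (negPf neq_qk).
Qed.

Lemma mnorm_steps j : (j <= p)%N -> mnorm (msteps s j) = j.
Proof.
move=> le_jp; rewrite /mnorm (reindex_inj (@perm_inj _ s)) /=.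
under eq_bigr do rewrite mstepsE.
rewrite -big_mkcond -(big_ord_widen p (fun=> 1%N)) // sum1_card card_ord //.
Qed.

Lemma msub_unitK n (k : 'I_p) : mle (munit k) n -> n = msub n (munit k) + munit k.
Proof.
by move=> le_kn; apply/ffunP => q; rewrite mindexDE ffunE subnK.
Qed.

Lemma add_steps_rest n (A : pred 'I_p) j : (forall u, A (s u) = (j <= u)%N) ->
  n + msteps s j + \sum_(q | A q) munit q = n + \sum_q munit q.
Proof.
move=> A_steps; rewrite -addrA; congr (_ + _).
rewrite [RHS](bigID A) addrC; congr (_ + _).
rewrite [RHS](reindex_inj (@perm_inj _ s)); apply: eq_bigl => u.
by rewrite /= A_steps -ltnNge.
Qed.
End Norm.

(** * The type I recurrence *)

Section ResidueRecurrence.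
Variables (R : numFieldType) (p : nat) (c : 'I_p -> R) (s : 'S_p).
Hypothesis c_inj : injective c.
Implicit Types (n m : mindex p) (M : nat).

(** Every residue involved is one for the multi-index [n + (1, ..., 1)] with a
    polynomial inserted: the factors [t - c_r] cancel the superfluous poles.
    The equality is thus [newton_identity] under a linear functional, with nodes
    [c_q - c_i] because the variable is [t - c_i]. *)
Lemma residue_newton (i : 'I_p) (x : R) n M : ((n i).+1 < M)%N ->
  \sum_q (n q)%:R * residue c i x M (n + munit q) 1 =
  \sum_(1 <= j < p.+1)
    newton_coef s c (fun q => (n q)%:R) j * residue c i x M (n + msteps s j) 1.
Proof.
move=> lt_nM; pose top := n + \sum_q munit q.
have residue0 : residue c i x M top 0 = 0.
  by rewrite /residue mul0r mulr0 coef0.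
have residue_sum := big_morph (residue c i x M top) (residueD c i x M top) residue0.
have small (m : mindex p) : (m i <= 1)%N -> ((n + m)%R i < M)%N.
  by rewrite mindexDE; lia.
pose a q := c q - c i.
transitivity (residue c i x M top
    (\sum_q (n q)%:R *: \prod_(r | r != q) ('X - (a r)%:P))).
  rewrite residue_sum; apply: eq_bigr => q _; rewrite residueZ; congr (_ * _).
  rewrite -[\prod_(r | _) _]mulr1 /top (bigD1 q) //= addrA.
  by rewrite residue_pole_steps // small // munitE leq_b1.
rewrite (newton_identity s) residue_sum; apply: eq_big_nat => j _.
rewrite residueZ; congr (_ * _).
  rewrite /newton_coef; apply: eq_bigr => r _; congr (_ * _).
  by apply: eq_bigr => q _; rewrite /a; ring.
pose A (q : 'I_p) := (j <= (s^-1)%g q)%N.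
have A_steps u : A (s u) = (j <= u)%N by rewrite /A permK.
have -> : \prod_(u : 'I_p | (j <= u)%N) ('X - (a (s u))%:P) =
    \prod_(q | A q) ('X - (a q)%:P) * 1.
  rewrite mulr1 [RHS](reindex_inj (@perm_inj _ s)).
  by apply: eq_bigl => u; rewrite A_steps.
rewrite /top -(add_steps_rest n A_steps) residue_pole_steps // small //.
by rewrite -[i](permKV s) mstepsE leq_b1.
Qed.

Lemma residue_nearest_neighbour (i k : 'I_p) (x : R) m M :
  let n := m + munit k in ((n i).+1 < M)%N ->
  x * residue c i x M n 1 =
  1 / 2 * residue c i x M m 1 + c k / 2 * residue c i x M n 1
  + \sum_(1 <= j < p.+1)
      newton_coef s c (fun q => (n q)%:R) j * residue c i x M (n + msteps s j) 1.
Proof.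
move=> n lt_nM; rewrite residue_by_parts ?(ltnW lt_nM) // residue_newton //.
congr (_ + _).
have -> : (c i)%:P + 'X = ('X - (c k - c i)%:P) * 1 + c k *: 1 :> {poly R}.
  rewrite mulr1 alg_polyC rmorphB /=; ring.
rewrite residueZ residueD residueZ residue_pole_step //; first ring.
by move: lt_nM; rewrite mindexDE; lia.
Qed.

(** The indices raised by [s_(j-1)] are those outside [Sset s j], over which [b^j]
    does not sum. *)
Lemma nnr_b_add_steps n j : (0 < j)%N ->
  nnr_b c s j (n + msteps s j.-1) = nnr_b c s j n.
Proof.
move=> j_gt0; rewrite /nnr_b; congr (_ * _); apply: eq_bigr => q.
rewrite -[q](permKV s) in_Sset => le_jq; rewrite mindexDE mstepsE.
by rewrite ltnNge (_ : j.-1 <= _)%N ?addn0 //; lia.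
Qed.

End ResidueRecurrence.

Section TypeIRecurrence.
Variables (R : realType) (p : nat) (c : 'I_p -> R) (s : 'S_p).
Hypothesis c_inj : injective c.
Implicit Types (n m : mindex p) (M : nat).

Theorem typeI_recurrence n (i k : 'I_p) :
  mle (munit k) n ->
  'X * hermite_typeI c n i =
    hermite_typeI c (msub n (munit k)) i
    + nnr_b0 c (msub n (munit k)) k *: hermite_typeI c n i
    + \sum_(1 <= j < p.+1)
        nnr_b c s j (n + msteps s j.-1)
          *: hermite_typeI c (n + msteps s j) i.
Proof.
move=> le_kn; have def_n := msub_unitK le_kn; set m := msub n _ in def_n *.
have mE : mnorm n = (mnorm m).+1 by rewrite def_n mnormD mnorm_unit addn1.
have le_mn : (m i <= n i)%N by rewrite def_n mindexDE leq_addr.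
have le_nj j : ((n + msteps s j)%R i <= (n i).+2)%N.
  rewrite mindexDE -[i](permKV s) mstepsE; case: (_ < j)%N => /=; lia.
(* The multi-indices [n + s_j] reach the order [(n i).+1] at [c i], and
   [residue_newton] needs one order more. *)
apply: poly_ext_horner => x; pose M := (n i).+2.
rewrite !hornerE horner_sum.
rewrite !(@horner_hermite_typeI _ _ c i c_inj x _ M) ?/M; try lia.
have := residue_nearest_neighbour s c_inj (i := i) (k := k) x (m := m) (M := M).
rewrite -def_n => /(_ (ltnSn _)) eq_res.
rewrite mulrCA eq_res !mulrDr mulr_sumr; congr (_ + _ + _).
- by rewrite mE exprS; field.
- by rewrite /nnr_b0; ring.
apply: eq_big_nat => j /andP[j_gt0 le_jp].
rewrite hornerZ (horner_hermite_typeI c_inj x (le_nj j)) nnr_b_add_steps //.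
rewrite nnr_b_newton mnormD mnorm_steps // exprD.
have : (2 : R) ^+ j != 0 by rewrite expf_neq0 // pnatr_eq0.
by move: (2 ^+ j : R) => w w_neq0; field; rewrite w_neq0.
Qed.
End TypeIRecurrence.

Theorem theorem5p2 (R : realType) (p : nat) (c : 'I_p -> R)
    (hc : injective c) (k : 'I_p) (s : 'S_p) :
  (forall n : {ffun 'I_p -> nat},
     (forall j : nat, (1 <= j <= p)%N -> mle (msteps s j) n) ->
     'X * hermite_typeII c n =
       hermite_typeII c (n + munit k)
       + nnr_b0 c n k *: hermite_typeII c n
       + \sum_(1 <= j < p.+1)
           nnr_b c s j n *: hermite_typeII c (msub n (msteps s j)))
  /\
  (forall (n : {ffun 'I_p -> nat}) (i : 'I_p),
     mle (munit k) n ->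
     'X * hermite_typeI c n i =
       hermite_typeI c (msub n (munit k)) i
       + nnr_b0 c (msub n (munit k)) k *: hermite_typeI c n i
       + \sum_(1 <= j < p.+1)
           nnr_b c s j (n + msteps s j.-1)
             *: hermite_typeI c (n + msteps s j) i).
Proof.
split=> [n|n i]; first exact: typeII_recurrence.
exact: typeI_recurrence.
Qed.
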